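(* Let $q\equiv 1\pmod 4$ be a prime such that $p=2q+1$ is prime, and let $\chi$ be any even Dirichlet character modulo $p$. Then there is no $\alpha\in\mathbb{R}$ such that $$\sum_{j=0}^n\delta_\chi(j)\,\delta_{\overline\chi}(n-j)=\alpha\,\sigma'_p(n)\quad\text{for all } n\ge1.$$
   Context: The bar denotes complex conjugation. $\delta_\chi(n)=\sum_{0<d\mid n}\chi(d)$ for $n>0$, and $\delta_\chi(0)=-\frac{1}{2p}\sum_{a=1}^{p-1}\chi(a)a$. $\sigma'_p(n)=\sum_{0<d\mid n,\ p\nmid d}d$ for $n>0$. A Dirichlet character $\chi$ is even if $\chi(-1)=1$. *)

(* Defs.v *)
From HB Require Import structures.
From mathcomp Require Import all_boot all_order all_algebra.
From mathcomp Require Import complex reals.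

Set Implicit Arguments.
Unset Strict Implicit.
Unset Printing Implicit Defensive.

Import Order.TTheory GRing.Theory Num.Theory.
Local Open Scope ring_scope.
Local Open Scope complex_scope.

(* The normalisation chi 1 = 1 follows from multiplicativity and the third
   clause at a = 1. *)
Definition dirichlet_character (R : realType) (m : nat) (chi : int -> R[i]) : Prop :=
  [/\ forall a : int, chi (a + m%:Z) = chi a,
      forall a b : int, chi (a * b) = chi a * chi b
    & forall a : int, chi a != 0 <-> coprimez a m%:Z].

Definition even_character (R : realType) (chi : int -> R[i]) : Prop :=
  chi (-1) = 1.

Definition conj_character (R : realType) (chi : int -> R[i]) : int -> R[i] :=
  fun a => (chi a)^*.

Definition delta (R : realType) (p : nat) (chi : int -> R[i]) (n : nat) : R[i] :=
  if n == 0%N then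
    - (2 * p%:R)^-1 * \sum_(1 <= a < p) chi a%:Z * a%:R
  else \sum_(d <- divisors n) chi d%:Z.

(* Only meaningful for n > 0: divisors 0 = [::], so the value at 0 is 0. *)
Definition sigma' (p n : nat) : nat :=
  (\sum_(d <- divisors n | ~~ (p %| d)) d)%N.

(* Main.v *)
(** Only the identities at n = 1 and n = 2 are needed. For even chi, pairing
    a with p - a gives delta(0) = - S / 4 with S the sum of chi over the residues
    mod p, and S is 0 or p - 1 by orthogonality. If S = 0, then delta(0) = 0 and the
    two identities read alpha = 0 and 1 = 3 alpha. If S = p - 1, then chi is trivial
    with delta(0) = - q / 2, and they read alpha = - q and 1 - 2 q = 3 alpha. *)

Require Import Defs.
From mathcomp Require Import all_boot all_order all_algebra.
From mathcomp Require Import complex reals.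
From mathcomp Require Import ring zify.

Import Order.TTheory GRing.Theory Num.Theory.
Local Open Scope ring_scope.
Local Open Scope complex_scope.

Section DirichletCharacter.
Context {R : realType} {p : nat} {chi : int -> R[i]}.
Hypothesis chiP : dirichlet_character p chi.

Lemma dirichlet_character_addM (a : int) (k : nat) : chi (a + (k * p)%:Z) = chi a.
Proof.
have [chiD _ _] := chiP.
by elim: k => [|k <-]; rewrite ?addr0 // mulSn addnC PoszD addrA chiD.
Qed.

Lemma dirichlet_character_modn (a : nat) : chi (a %% p)%N = chi a.
Proof.
by rewrite [in RHS](divn_eq a p) addnC PoszD dirichlet_character_addM.
Qed.

Lemma dirichlet_character1 : chi 1 = 1.
Proof.
have [_ chiM chi0] := chiP.
have nz1 : chi 1 != 0 by apply/chi0; rewrite /coprimez gcd1z.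
by apply: (mulfI nz1); rewrite -chiM !mulr1.
Qed.

(** As [b] is invertible mod [p], the map taking [a] to [b * a] mod [p] permutes the residues, so
    the factor [chi b] only reorders the sum. *)
Lemma sum_dirichlet_character_mul (b : nat) : (0 < p)%N -> coprime b p ->
  chi b * (\sum_(a < p) chi a) = \sum_(a < p) chi a.
Proof.
move=> p_gt0 copb; have [_ chiM _] := chiP.
pose h (a : 'I_p) := Ordinal (ltn_pmod (b * a) p_gt0).
have h_inj : injective h.
  move=> x y /(congr1 val) /= /eqP exy; apply: val_inj.
  (* Ordering [x] and [y] lets the congruence become divisibility of a natural-number difference,
     from which [b] cancels. *)
  wlog lexy : x y exy / (x <= y)%N.
    by move=> W; case/orP: (leq_total x y) => /W; [|rewrite eq_sym => ->] => // ->.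
  move: exy; rewrite eq_sym eqn_mod_dvd ?leq_mul2l ?lexy ?orbT //.
  rewrite -mulnBr Gauss_dvdr 1?coprime_sym // -eqn_mod_dvd //.
  by rewrite !modn_small // => /eqP.
rewrite [RHS](reindex_inj h_inj) mulr_sumr; apply: eq_bigr => a _ /=.
by rewrite dirichlet_character_modn PoszM chiM.
Qed.

(** A nonzero sum can be cancelled from the invariance under multiplication by [chi b], which forces
    [chi b = 1] for every [b] coprime to [p]. *)
Lemma sum_dirichlet_character : prime p ->
  \sum_(1 <= a < p) chi a = 0 \/
  (forall b : nat, coprime b p -> chi b = 1) /\ \sum_(1 <= a < p) chi a = p.-1%:R.
Proof.
move=> p_pr; have p_gt0 := prime_gt0 p_pr; have [_ _ chi0] := chiP.
(* The permutation argument runs over all residues; this removes the term at 0. *)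
have chi0E : chi 0 = 0.
  apply/eqP/negPn/negP => /chi0; rewrite /coprimez gcd0z /=.
  by rewrite eqz_nat eqn_leq leqNgt prime_gt1.
have sumE : \sum_(a < p) chi a = \sum_(1 <= a < p) chi a.
  by rewrite -(big_mkord xpredT (fun a : nat => chi a)) big_ltn // chi0E add0r.
have [->|nzS] := eqVneq (\sum_(1 <= a < p) chi a) 0; [by left | right].
have chi_eq1 (b : nat) : coprime b p -> chi b = 1.
  move=> copb; apply: (mulIf nzS).
  by rewrite -sumE sum_dirichlet_character_mul // mul1r.
split=> //.
rewrite -subn1 -[RHS]sumr_const_nat; apply: eq_big_nat => a /andP[a_gt0 ltap].
by apply: chi_eq1; rewrite coprime_sym prime_coprime // gtnNdvd.
Qed.

Lemma delta0_even : even_character chi -> (0 < p)%N ->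
  delta p chi 0 = - (\sum_(1 <= a < p) chi a) / 4.
Proof.
move=> chi_even p_gt0; have [chiD chiM _] := chiP.
have nzp : p%:R != 0 :> R[i] by rewrite pnatr_eq0 -lt0n.
rewrite /delta eqxx; set T := \sum_(1 <= a < p) _; set S := \sum_(1 <= a < p) _.
suff TE : T + T = p%:R * S.
  have -> : T = p%:R * S / 2 by rewrite -TE; field.
  by field.
(* Only one copy of [T] is reversed, so the weights [p - a] and [a] meet in one term and add up to
   [p]. *)
rewrite {1}/T big_nat_rev /T -big_split /= /S mulr_sumr.
apply: eq_big_nat => a /andP[a_gt0 ltap].
rewrite add1n subSS; have -> : chi (p - a)%N = chi a.
  by rewrite -subzn 1?ltnW // addrC chiD -mulN1r chiM chi_even mul1r.
by rewrite natrB 1?ltnW //; ring.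
Qed.

End DirichletCharacter.

(** All coefficients of the character values in [delta] are rational, hence fixed by conjugation. *)
Lemma delta_conj (R : realType) (p : nat) (chi : int -> R[i]) (n : nat) :
  delta p (conj_character chi) n = (delta p chi n)^*.
Proof.
rewrite /delta; case: eqP => _; last by rewrite rmorph_sum.
rewrite rmorphM rmorphN fmorphV rmorphM !rmorph_nat rmorph_sum; congr (_ * _).
by apply: eq_bigr => a _; rewrite rmorphM rmorph_nat.
Qed.

Theorem theorem4 (R : realType) (p q : nat) (hq : prime q)
    (hq4 : q = 1 %[mod 4]) (hpq : p = (2 * q + 1)%N) (hp : prime p)
    (chi : int -> R[i]) (hchi : dirichlet_character p chi)
    (heven : even_character chi) :
  ~ exists alpha : R, forall n : nat, (1 <= n)%N ->
      \sum_(0 <= j < n.+1) delta p chi j * delta p (conj_character chi) (n - j)%N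
      = alpha%:C * (sigma' p n)%:R.
Proof.
case=> alpha h.
have q_gt1 := prime_gt1 hq.
have p_gt2 : (2 < p)%N by lia.
(* Thus the divisor 2 counts in [sigma' p 2], and 2 is coprime to [p]. *)
have Ndvd2 : (p %| 2)%N = false by rewrite gtnNdvd.
have delta1 : delta p chi 1 = 1.
  by rewrite /delta /= big_seq1 (dirichlet_character1 hchi).
have delta2 : delta p chi 2 = 1 + chi 2.
  by rewrite /delta /= big_cons big_seq1 (dirichlet_character1 hchi).
have sigma1 : sigma' p 1 = 1%N.
  by rewrite /sigma' /= big_cons big_nil dvdn1 eqn_leq leqNgt prime_gt1.
have sigma2 : sigma' p 2 = 3%N.
  by rewrite /sigma' /= !big_cons big_nil Ndvd2 dvdn1 eqn_leq leqNgt prime_gt1.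
have := h 1%N isT; have := h 2%N isT.
rewrite !big_nat_recr //= !big_nil !delta_conj subnn !subn0 subSS subn0.
rewrite delta2 delta1 sigma1 sigma2 rmorph1 (delta0_even hchi heven) ?prime_gt0 //.
have cop2p : coprime 2 p by rewrite coprime_sym prime_coprime // Ndvd2.
have [->|[/(_ 2%N cop2p) -> ->]] := sum_dirichlet_character hchi hp.
  rewrite oppr0 mul0r rmorph0 !mul0r !mulr0 !add0r !mulr1 addr0 => + alpha0.
  by rewrite -alpha0 mul0r => /eqP; rewrite oner_eq0.
have -> : - p.-1%:R / 4 = - (q%:R / 2) :> R[i].
  by rewrite hpq addn1 /= natrM; field.
have -> : (- (q%:R / 2) : R[i])^* = - (q%:R / 2).
  by rewrite rmorphN rmorphM fmorphV !rmorph_nat.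
rewrite rmorphD rmorph1 => E2 E1.
have alphaE : alpha%:C = - q%:R by rewrite -[LHS]mulr1 -E1; field.
(* The two sides differ by [(1 - 2q) + 3q = q + 1], which is nonzero in characteristic 0. *)
move/eqP: E2; rewrite alphaE -subr_eq0 (_ : _ - _ = q.+1%:R) ?pnatr_eq0 //.
by rewrite -natr1; field.
Qed.
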